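(* Let $R\subset T$ be a minimal ring extension where $R$ is a von Neumann regular ring. Then either $T$ is a von Neumann regular ring, or $T\cong R(+)R/\mathfrak{m}$ as $R$-algebras for some maximal ideal $\mathfrak{m}$ of $R$.
   Context: All rings are commutative with nonzero identity, and all ring extensions (subrings), ring homomorphisms and algebra homomorphisms are unital. For a proper subring $R$ of a ring $T$, the extension $R\subset T$ is called a minimal ring extension (equivalently, $R$ is a maximal subring of $T$) if there is no ring $S$ with $R\subset S\subset T$, where $\subset$ denotes proper inclusion. For a ring $R$ and an $R$-module $E$, the idealization $R(+)E$ is the ring whose additive group is $R\oplus E$ with multiplication $(r_1,e_1)(r_2,e_2)=(r_1r_2,\,r_1e_2+r_2e_1)$; it is an $R$-algebra via $r\mapsto (r,0)$. Here $R(+)R/\mathfrak{m}$ means the idealization of the $R$-module $R/\mathfrak{m}$. *)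

(* Defs.v *)
From HB Require Import structures.
From mathcomp Require Import all_boot all_algebra ring_quotient.
From mathcomp Require Import classical_sets.

Set Implicit Arguments.
Unset Strict Implicit.
Unset Printing Implicit Defensive.

Import GRing.Theory.
Local Open Scope ring_scope.
Local Open Scope classical_set_scope.
Local Open Scope quotient_scope.

Definition von_neumann_regular (A : comNzRingType) : Prop :=
  forall x : A, exists y : A, x = x * y * x.

(* The base ring R is identified with its image in the R-algebra T under the
   structure map r |-> r%:A = in_alg T r, which is required to be injective. *)
Definition minimal_ring_extension (R : comNzRingType) (T : comAlgType R) : Prop :=
  [/\ injective (in_alg T),
      range (in_alg T) `<` [set: T]
    & ~ exists S : set T,
          [/\ GRing.subring_closed (mem S), range (in_alg T) `<` S
            & S `<` [set: T]] ].

(* Every I : idealr R is proper, since 1 \notin I is part of the structure. *)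
Definition maximal_ideal (R : comNzRingType) (I : idealr R) : Prop :=
  forall J : idealr R, {subset I <= J} -> {subset J <= I}.

Section QuotientModule.
Variables (R : comNzRingType) (I : idealr R).

Definition ideal_quot_scale (a : R) (x : {ideal_quot I}) : {ideal_quot I} :=
  \pi_{ideal_quot I} a * x.

Lemma ideal_quot_scaleA a b x :
  ideal_quot_scale a (ideal_quot_scale b x) = ideal_quot_scale (a * b) x.
Proof. by rewrite /ideal_quot_scale mulrA rmorphM. Qed.

Lemma ideal_quot_scale1 : left_id 1 ideal_quot_scale.
Proof. by move=> x; rewrite /ideal_quot_scale rmorph1 mul1r. Qed.

Lemma ideal_quot_scaleDr : right_distributive ideal_quot_scale +%R.
Proof. by move=> a x y; rewrite /ideal_quot_scale mulrDr. Qed.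

Lemma ideal_quot_scaleDl x : {morph ideal_quot_scale^~ x : a b / a + b}.
Proof. by move=> a b; rewrite /ideal_quot_scale rmorphD mulrDl. Qed.

HB.instance Definition _ := GRing.Zmodule_isLmodule.Build R {ideal_quot I}
  ideal_quot_scaleA ideal_quot_scale1 ideal_quot_scaleDr ideal_quot_scaleDl.

End QuotientModule.

(* An alias of R * E, which keeps the ring structure below apart from the
   componentwise one that the library puts on a product of two rings. *)
Definition idealization (R : comNzRingType) (E : lmodType R) : Type :=
  (R^o * E)%type.

Section Idealization.
Variables (R : comNzRingType) (E : lmodType R).
Local Notation RE := (idealization E).

HB.instance Definition _ := GRing.Lmodule.copy RE (R^o * E)%type.

Definition idealization_one : RE := (1, 0).
Definition idealization_mul (u v : RE) : RE :=
  (u.1 * v.1, u.1 *: v.2 + v.1 *: u.2).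

Lemma idealization_mulA : associative idealization_mul.
Proof.
move=> [a x] [b y] [c z]; congr (_, _) => /=; first exact: mulrA.
by rewrite !scalerDr !scalerA -addrA (mulrC c a) (mulrC c b).
Qed.

Lemma idealization_mulC : commutative idealization_mul.
Proof. by move=> [a x] [b y]; congr (_, _); [exact: mulrC | exact: addrC]. Qed.

Lemma idealization_mul1 : left_id idealization_one idealization_mul.
Proof.
move=> [a x]; congr (_, _) => /=; first exact: mul1r.
by rewrite scale1r scaler0 addr0.
Qed.

Lemma idealization_mulDl : left_distributive idealization_mul +%R.
Proof.
move=> [a x] [b y] [c z]; congr (_, _) => /=; first exact: mulrDl.
by rewrite scalerDl scalerDr addrACA.
Qed.

Lemma idealization_one_neq0 : idealization_one != 0.
Proof. by apply/eqP => -[/eqP]; rewrite oner_eq0. Qed.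

HB.instance Definition _ := GRing.Zmodule_isComNzRing.Build RE
  idealization_mulA idealization_mulC idealization_mul1 idealization_mulDl
  idealization_one_neq0.

Lemma idealization_scaleAl (a : R) (u v : RE) : a *: (u * v) = (a *: u) * v.
Proof.
case: u v => [b x] [c y]; congr (_, _) => /=; first exact: mulrA.
by rewrite scalerDr !scalerA (mulrC c a).
Qed.

HB.instance Definition _ :=
  GRing.Lmodule_isLalgebra.Build R RE idealization_scaleAl.
HB.instance Definition _ := GRing.Lalgebra_isComAlgebra.Build R RE.

Lemma idealization_in_algE (r : R) : r%:A = (r, 0) :> RE.
Proof. by congr (_, _); [exact: mulr1 | exact: scaler0]. Qed.

End Idealization.

(* Main.v *)
Require Import Defs.
From HB Require Import structures.
From mathcomp Require Import all_boot all_algebra ring_quotient.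
From mathcomp Require Import classical_sets.
From mathcomp Require Import boolp ring.

Set Implicit Arguments.
Unset Strict Implicit.
Unset Printing Implicit Defensive.

Import GRing.Theory.
Local Open Scope ring_scope.
Local Open Scope quotient_scope.

(** Write [R] for its image in [T].  Minimality is only ever used on subrings
    of the form [R + I], where [I] is an [R]-submodule of [T] closed under
    products: either [I] lies in [R], or [R + I] is all of [T]
    ([minimal_extension_dichotomy]).

    Suppose first that [T] is reduced, and take [t] in [T] and [I = t^2 T].
    If [I] lies in [R] then [t^2] is in [R], hence is regular, and reducedness
    turns a quasi-inverse of [t^2] into one of [t].  Otherwise [t = a + t^2 u]
    with [a] in [R].  The idempotent [e] generating [aR] splits [T]: on the
    factor where [e = 0] this reads [t = t^2 u], and on the factor where
    [e = 1] the element [a = t (1 - t u)] is invertible, so [t] is a unit.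
    Either way [t] is in [t^2 T], which is regularity in a commutative ring.

    Suppose now that [x] is a nonzero element of [T] with [x^2 = 0].  As [R] is
    reduced, [R] meets [R x] in [0], so the dichotomy for [I = R x] gives
    [T = R (+) R x], and [R x] is isomorphic to [R / m] with [m = ann_R x].
    For an ideal [J] containing [m], the dichotomy for [I = J x] says that
    [J x] is [0] or [R x], that is, [J] is [m] or [R]; so [m] is maximal. *)

(** * Extensions of a ring by a square-zero element *)

Lemma regular_square_eq0 (R : comNzRingType) (r : R) :
  von_neumann_regular R -> r * r = 0 -> r = 0.
Proof. by move=> /(_ r)[y ry] r0; rewrite ry mulrAC r0 mul0r. Qed.

Lemma annihilator_idealr (R : comNzRingType) (E : lmodType R) (x : E) :
  x != 0 -> exists m : idealr R, forall r, (r \in m) = (r *: x == 0).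
Proof.
move=> x0; pose P : {pred R} := fun r => r *: x == 0.
have idP : idealr_closed P.
  split; rewrite ?unfold_in /P ?scale0r ?scale1r //.
  move=> a u v; rewrite !unfold_in /P => /eqP ux /eqP vx.
  by rewrite scalerDl -scalerA ux vx scaler0 addr0.
by exists (HB.pack_for (idealr R) P (isIdealr.Build R P idP)).
Qed.

(** The isomorphism sends [r + s x] to [(r, s mod m)]; it is well defined
    because the sum of [R] and [R x] is direct and [m] is the annihilator of
    [x], and multiplicative because [x^2 = 0]. *)
Lemma square_zero_idealization (R : comNzRingType) (T : comAlgType R)
    (m : idealr R) (x : T) :
    x * x = 0 ->
    (forall r, (r \in m) = (r *: x == 0)) ->
    (forall r s, r%:A = s *: x -> r = 0) ->
    (forall t, exists r s, t = r%:A + s *: x) ->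
  exists f : {lrmorphism T -> idealization {ideal_quot m}}, bijective f.
Proof.
move=> xx mE direct gen.
have piE s s' : (s *: x = s' *: x) <-> (\pi_{ideal_quot m} s = \pi s').
  split=> [ss'|/eqP]; last first.
    by rewrite -Quotient.idealrBE mE scalerBl subr_eq0 => /eqP.
  by apply/eqP; rewrite -Quotient.idealrBE mE scalerBl ss' subrr.
have uniq r s r' s' : r%:A + s *: x = r'%:A + s' *: x ->
    (r, \pi_{ideal_quot m} s) = (r', \pi_{ideal_quot m} s').
  move=> rsE; have rr' : r = r'.
    apply/eqP; rewrite -subr_eq0; apply/eqP; apply: (direct _ (s' - s)).
    rewrite !scalerBl -[r%:A](addrK (s *: x)) rsE.
    by rewrite addrAC [X in X - _]addrC addKr.
  congr (_, _) => //; apply/piE.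
  by move: rsE; rewrite rr' => /addrI.
have gen' (t : T) : exists p : R * R, t == p.1%:A + p.2 *: x.
  by have [r [s ->]] := gen t; exists (r, s).
pose f (t : T) : idealization {ideal_quot m} :=
  ((xchoose (gen' t)).1, \pi_{ideal_quot m} (xchoose (gen' t)).2).
have fE r s : f (r%:A + s *: x) = (r, \pi_{ideal_quot m} s).
  by apply: uniq; apply/esym/eqP; apply: (xchooseP (gen' _)).
have lin_f : linear f.
  move=> a t u; have [r [s ->]] := gen t; have [r' [s' ->]] := gen u.
  have -> : a *: (r%:A + s *: x) + (r'%:A + s' *: x)
      = (a * r + r')%:A + (a * s + s') *: x :> T.
    by rewrite scalerDr !scalerA !scalerDl addrACA.
  by rewrite !fE; congr (_, _); rewrite rmorphD rmorphM.
have mul_f : monoid_morphism f.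
  split=> [|t u].
    have -> : 1 = 1%:A + 0 *: x :> T by rewrite scale1r scale0r addr0.
    by rewrite fE rmorph0.
  have [r [s ->]] := gen t; have [r' [s' ->]] := gen u.
  have -> : (r%:A + s *: x) * (r'%:A + s' *: x)
      = (r * r')%:A + (r * s' + r' * s) *: x :> T.
    rewrite mulrDl !mulrDr -!scalerAl -!scalerAr xx !mul1r mulr1 !scaler0 addr0.
    by rewrite !scalerA scalerDl addrA (mulrC s).
  by rewrite !fE; congr (_, _); rewrite rmorphD !rmorphM.
pose fM := GRing.isMonoidMorphism.Build _ _ f mul_f.
pose fL := GRing.isLinear.Build R T _ _ f lin_f.
pose g (p : idealization {ideal_quot m}) : T := (p.1 : R)%:A + repr p.2 *: x.
exists (HB.pack_for {lrmorphism T -> idealization {ideal_quot m}} f fL fM).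
have fK : cancel f g.
  move=> t; have [r [s ->]] := gen t; rewrite fE /g /=.
  by congr (_ + _); apply/piE; rewrite reprK.
have gK : cancel g f by move=> [r q]; rewrite /g /= fE reprK.
exact: Bijective fK gK.
Qed.

(** * Minimal extensions *)

(** [R + I] is then a ring between [R] and [T], so minimality makes it [R]
    or [T]. *)
Lemma minimal_extension_dichotomy (R : comNzRingType) (T : comAlgType R)
    (I : set T) :
    minimal_ring_extension T ->
    I 0 -> (forall x y, I x -> I y -> I (x - y)) ->
    (forall a x, I x -> I (a *: x)) -> (forall x y, I x -> I y -> I (x * y)) ->
  (forall x, I x -> exists r, x = r%:A) \/
  (forall t, exists r, exists2 x, I x & t = r%:A + x).
Proof.
move=> [_ _ noS] I0 IB IZ IM.
have ID x y : I x -> I y -> I (x + y).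
  by move=> Ix Iy; rewrite -[y]opprK -[- y]sub0r; apply/IB/IB.
have [|/existsNP[x /not_implyP[Ix xR]]] :=
  pselect (forall x, I x -> exists r, x = r%:A); first by left.
right=> t; apply: contrapT => tS; apply: noS.
exists (fun t => exists r, exists2 x, I x & t = r%:A + x); split.
- split.
  + by rewrite inE; exists 1, 0; rewrite ?scale1r ?addr0.
  + move=> _ _ /[!inE] -[r [y Iy ->]] [s [z Iz ->]].
    exists (r - s), (y - z); first exact: IB.
    by rewrite scalerBl opprD addrACA.
  + move=> _ _ /[!inE] -[r [y Iy ->]] [s [z Iz ->]].
    exists (r * s), (r *: z + (s *: y + y * z)).
      exact: ID (IZ _ _ Iz) (ID _ _ (IZ _ _ Iy) (IM _ _ Iy Iz)).
    by rewrite mulrDl !mulrDr -!scalerAl -!scalerAr !mul1r mulr1 scalerA !addrA.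
- split=> [_ [r _ <-]|SR]; first by exists r, 0; rewrite ?addr0.
  have /SR[r _ rx] : exists r, exists2 y, I y & x = r%:A + y.
    by exists 0, x; rewrite // scale0r add0r.
  by apply: xR; exists r.
- by split=> // /(_ t Logic.I).
Qed.

Lemma reduced_minimal_extension_regular (R : comNzRingType) (T : comAlgType R) :
    minimal_ring_extension T -> von_neumann_regular R ->
    (forall x : T, x * x = 0 -> x = 0) ->
  von_neumann_regular T.
Proof.
move=> minRT vnrR redT t.
have regA (r : R) : exists b : T, r%:A = r%:A * b * r%:A :> T.
  have [b rbr] := vnrR r; exists b%:A.
  by rewrite {1}rbr -[LHS]/(in_alg T _) !rmorphM.
have [|_ _ [u ->] [v ->]|a _ [u ->]|_ _ [u ->] [v ->]|sqR|sqT] :=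
  @minimal_extension_dichotomy R T (fun y => exists u, y = t * t * u) minRT.
- by exists 0; rewrite mulr0.
- by exists (u - v); rewrite mulrBr.
- by exists (a *: u); rewrite scalerAr.
- by exists (u * (t * t * v)); rewrite mulrA.
- have [a ta] : exists a, t * t = a%:A by apply: sqR; exists 1; rewrite mulr1.
  have [b] := regA a; rewrite -ta => tb; exists (t * b).
  (* t - t b t^2 has square a multiple of t^2 - t^2 b t^2 = 0 *)
  apply/eqP; rewrite -subr_eq0; apply/eqP/redT.
  have -> : (t - t * (t * b) * t) * (t - t * (t * b) * t)
    = (t * t - t * t * b * (t * t)) * (1 - t * t * b) by ring.
  by rewrite -tb subrr mul0r.
- have [a [_ [u ->] tE]] := sqT t; have [b ab] := regA a.
  (* a quasi-inverse of t is u where ab = 0, and b (1 - t u) where ab = 1 *)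
  exists (u * (1 - a%:A * b) + b * (1 - t * u)).
  have aE : a%:A = t - t * t * u by rewrite {1}tE addrK.
  have -> : t * (u * (1 - a%:A * b) + b * (1 - t * u)) * t
    = t * t * u * (1 - a%:A * b) + t * b * (t - t * t * u) by ring.
  rewrite -aE.
  have -> : t * t * u = t - a%:A by rewrite aE opprB addrC subrK.
  have -> : (t - a%:A) * (1 - a%:A * b) + t * b * a%:A
    = t - a%:A + a%:A * b * a%:A by ring.
  by rewrite -ab subrK.
Qed.

Lemma nonreduced_minimal_extension (R : comNzRingType) (T : comAlgType R)
    (x : T) :
    minimal_ring_extension T -> von_neumann_regular R ->
    x != 0 -> x * x = 0 ->
  exists m : idealr R, maximal_ideal m /\
    exists f : {lrmorphism T -> idealization {ideal_quot m}}, bijective f.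
Proof.
move=> minRT vnrR x0 xx; have [inj _ _] := minRT.
have sqx r s : (r *: x) * (s *: x) = 0.
  by rewrite -scalerAl -scalerAr xx !scaler0.
have direct r s : r%:A = s *: x -> r = 0.
  move=> rs; apply: regular_square_eq0 => //; apply: inj.
  by rewrite rmorphM rmorph0 /= rs sqx.
have dichot (J : set R) : J 0 -> (forall j k, J j -> J k -> J (j - k)) ->
    (forall a j, J j -> J (a * j)) ->
    (forall j, J j -> j *: x = 0) \/
    (forall t, exists r, exists2 j, J j & t = r%:A + j *: x).
  move=> J0 JB JM.
  have [|_ _ [j Jj ->] [k Jk ->]|a _ [j Jj ->]|_ _ [j Jj ->] [k Jk ->]|JR|JT] :=
    @minimal_extension_dichotomy R T (fun y => exists2 j, J j & y = j *: x)
      minRT.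
  - by exists 0; rewrite ?scale0r.
  - by exists (j - k); rewrite ?scalerBl //; exact: JB.
  - by exists (a * j); rewrite ?scalerA //; exact: JM.
  - by exists 0; rewrite ?sqx ?scale0r.
  - left=> j Jj; have [|r jr] := JR (j *: x); first by exists j.
    by rewrite jr (direct r j) ?scale0r.
  - right=> t; have [r [_ [j Jj ->] ->]] := JT t.
    by exists r, j.
have [m mE] := annihilator_idealr x0.
exists m; split.
  move=> J mJ j Jj; rewrite mE; apply/eqP.
  have [|k l|a k|/(_ j Jj)//|/(_ x)[r [k Jk xE]]] := dichot (fun k => k \in J).
  - exact: idealr0.
  - exact: rpredB.
  - exact: idealMr.
  (* in the case T = R + J x, x = r + k x puts (1 - k) x in R: it is 0 *)
  have rE : r%:A = (1 - k) *: x.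
    by rewrite scalerBl scale1r {1}xE addrK.
  have /mJ J1k : 1 - k \in m by rewrite mE -rE (direct _ _ rE) scale0r.
  by have := idealr1 J; rewrite -(subrK k 1) rpredD.
apply: (@square_zero_idealization _ _ m x) => // t.
have [||||/(_ t)[r [j _ ->]]] // := dichot setT; last by exists r, j.
by move=> /(_ 1 Logic.I) /eqP; rewrite scale1r (negPf x0).
Qed.

Theorem theorem2p1 (R : comNzRingType) (T : comAlgType R)
    (minRT : minimal_ring_extension T) (vnrR : von_neumann_regular R) :
  von_neumann_regular T \/
  exists m : idealr R, maximal_ideal m /\
    exists f : {lrmorphism T -> idealization {ideal_quot m}}, bijective f.
Proof.
have [redT|/existsNP[x /not_implyP[xx /eqP x0]]] :=
  pselect (forall x : T, x * x = 0 -> x = 0).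
  by left; exact: (reduced_minimal_extension_regular minRT).
by right; exact: (nonreduced_minimal_extension minRT vnrR x0).
Qed.
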